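(* Let $N$ be a positive integer and let $a_n>0$, $b_n\in\mathbb{R}$ ($n\ge0$). Suppose that $r$ and $q$ are real $N$-periodic sequences such that $$\prod_{i=0}^{N-1}\begin{pmatrix}0&1\\-r_i&-q_i\end{pmatrix}=\gamma\,\mathrm{Id},\qquad\gamma\in\{-1,1\}.$$ Assume $$\mathcal{V}_N\Big(\frac1{a_n}:n\ge0\Big)+\mathcal{V}_N\big(r_na_n-a_{n-1}:n\ge1\big)+\mathcal{V}_N\big(b_n-q_na_n:n\ge0\big)<\infty,$$ and that (a) $\lim_{n\to\infty}a_n=\infty$, (b) $\lim_{n\to\infty}|r_na_n-a_{n-1}-s_n|=0$, (c) $\lim_{n\to\infty}|b_n-q_na_n-z_n|=0$ for some real $N$-periodic sequences $s$ and $z$. Let $h_0$ be the real polynomial, determined by $r,q,s,z$, that is defined in the context, and put $$I(s,z)=\{\lambda\in\mathbb{R}:h_0(\lambda)\le0\},\qquad\Lambda=\mathbb{R}\setminus I(s,z).$$ Then $I(s,z)$ is a compact interval, and for every compact set $K\subset\Lambda$ there are constants $c_1,c_2>0$ such that for every $x\in K$, every (real) generalised eigenvector $u$ associated with $x$ and every $n\ge1$ $$c_1(u_0^2+u_1^2)\le a_n(u_{n-1}^2+u_n^2)\le c_2(u_0^2+u_1^2).$$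
   Context: Total $N$-variation: $\mathcal{V}_N(x_n:n\ge m)=\sum_{n=m}^\infty|x_{n+N}-x_n|$. A generalised eigenvector associated with $x\in\mathbb{R}$ is a sequence $(u_n:n\ge0)$ with $a_{n-1}u_{n-1}+b_nu_n+a_nu_{n+1}=xu_n$ for all $n\ge1$. For matrices, $\prod_{k=n_0}^{n_1}C_k=C_{n_1}C_{n_1-1}\cdots C_{n_0}$ if $n_1\ge n_0$ and $=\mathrm{Id}$ otherwise. $N$-periodic sequences are regarded as indexed by $\mathbb{Z}$. Definition of $h_0$. Let $\alpha,\beta$ be the $N$-periodic sequences with $\alpha_i=\prod_{k=i+1}^{N-1}r_k$ (empty product $=1$), $\beta_i=\alpha_iq_i$ for $i=0,\dots,N-1$; then $r_i=\alpha_{i-1}/\alpha_i$ and $q_i=\beta_i/\alpha_i$ for all $i$. Let $\hat{\mathcal B}^j(\lambda)=\begin{pmatrix}0&1\\-\frac{\alpha_{j-1}}{\alpha_j}&\frac{\lambda-\beta_j}{\alpha_j}\end{pmatrix}$. For $k\ge0$ let $(w^{[k]}_n:n\ge0)$ be the polynomials given by $w^{[k]}_0=1$, $w^{[k]}_1(x)=\frac{x-\beta_k}{\alpha_k}$ and $\alpha_{n+k-1}w^{[k]}_{n-1}(x)+\beta_{n+k}w^{[k]}_n(x)+\alpha_{n+k}w^{[k]}_{n+1}(x)=xw^{[k]}_n(x)$, $n\ge1$. (The assumption on the matrix product forces $N\ge2$.) For $i\ge0$ set $$\hat{\mathcal C}^i(\lambda)=\lambda\begin{pmatrix}-\frac{\alpha_{i-1}}{\alpha_i}(w^{[i+1]}_{N-2})'(0)&(w^{[i]}_{N-1})'(0)\\-\frac{\alpha_{i-1}}{\alpha_i}(w^{[i+1]}_{N-1})'(0)&(w^{[i]}_{N})'(0)\end{pmatrix},$$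 $$\mathcal D_i=\sum_{j=0}^{N-1}\frac1{\alpha_{i+j}}\Big[\prod_{m=j+1}^{N-1}\hat{\mathcal B}^{i+m}(0)\Big]\begin{pmatrix}0&0\\ s_{i+j}&-z_{i+j}\end{pmatrix}\Big[\prod_{m=0}^{j-1}\hat{\mathcal B}^{i+m}(0)\Big],$$ $\mathcal C_i(\lambda)=\alpha_{i-1}\mathcal D_i+\alpha_{i-1}\hat{\mathcal C}^i(\lambda)$, and $h_i(\lambda)=-\mathrm{discr}[\mathcal C_i(\lambda)]$, where $\mathrm{discr}(C)=(\mathrm{tr}\,C)^2-4\det C$. *)

(* Defs.v *)
From HB Require Import structures.
From mathcomp Require Import all_boot all_order all_algebra.
From mathcomp Require Import all_classical all_reals all_analysis.

Set Implicit Arguments.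
Unset Strict Implicit.
Unset Printing Implicit Defensive.

Import Order.TTheory GRing.Theory Num.Theory.
Import numFieldNormedType.Exports.

Local Open Scope classical_set_scope.
Local Open Scope ring_scope.

Section Definitions.
Variable R : realType.
Implicit Types (a b u x : nat -> R) (r q s z : int -> R) (N : nat) (i j k : int).

Definition nperiodic N (f : int -> R) : Prop := forall i, f (i + N%:Z) = f i.

(* The N-periodic sequence on the integers with values f 0, ..., f (N - 1). *)
Definition periodize N (f : nat -> R) : int -> R := fun i => f `|(i %% N%:Z)%Z|%N.

Definition Nvariation N (m : nat) x : \bar R :=
  (\sum_(m <= n <oo) `|x (n + N)%N - x n|%:E)%E.

Definition gen_eigenvector a b (x : R) (u : nat -> R) : Prop :=
  forall n : nat, (1 <= n)%N ->
    a n.-1 * u n.-1 + b n * u n + a n * u n.+1 = x * u n.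

Definition mx22 (c00 c01 c10 c11 : R) : 'M[R]_2 :=
  \matrix_(i < 2, j < 2)
    if i == 0 then (if j == 0 then c00 else c01)
    else (if j == 0 then c10 else c11).

(* C (n - 1) * ... * C m, the factors in decreasing order of the index;
   the upper bound n is excluded. *)
Definition mxprod (m n : nat) (C : nat -> 'M[R]_2) : 'M[R]_2 :=
  \prod_(l <- rev (index_iota m n)) C l.

Definition discr (C : 'M[R]_2) : R := (\tr C) ^+ 2 - 4 * \det C.

Definition alpha N r : int -> R :=
  periodize N (fun n => \prod_(n.+1 <= l < N) r l%:Z).

Definition beta N r q : int -> R :=
  periodize N (fun n => alpha N r n%:Z * q n%:Z).

Definition Bhat N r q j (lambda : R) : 'M[R]_2 :=
  mx22 0 1
    (- (alpha N r (j - 1) / alpha N r j))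
    ((lambda - beta N r q j) / alpha N r j).

(* The three-term recurrence solved for its leading term: with n' = n''.+1,
   alpha_{n'+k-1} w_{n''} + beta_{n'+k} w_{n'} + alpha_{n'+k} w_{n'+1} = X w_{n'}. *)
Fixpoint wpol N r q k (n : nat) {struct n} : {poly R} :=
  match n with
  | 0 => 1
  | 1 => (alpha N r k)^-1 *: ('X - (beta N r q k)%:P)
  | (n''.+1 as n').+1 =>
      (alpha N r (n'%:Z + k))^-1 *:
        (('X - (beta N r q (n'%:Z + k))%:P) * wpol N r q k n'
         - alpha N r (n'%:Z + k - 1) *: wpol N r q k n'')
  end.

Definition dw0 N r q k (n : nat) : R := ((wpol N r q k n)^`()).[0].

(* N - 2 is a truncated subtraction: for N = 1 the definition has no meaning, but
   then a product of the matrices mx22 0 1 (- r i) (- q i) is never scalar. *)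
Definition Chat N r q i (lambda : R) : 'M[R]_2 :=
  lambda *: mx22
    (- (alpha N r (i - 1) / alpha N r i) * dw0 N r q (i + 1) (N - 2))
    (dw0 N r q i (N - 1))
    (- (alpha N r (i - 1) / alpha N r i) * dw0 N r q (i + 1) (N - 1))
    (dw0 N r q i N).

Definition Dmx N r q s z i : 'M[R]_2 :=
  \sum_(0 <= l < N)
    (alpha N r (i + l%:Z))^-1 *:
      (mxprod l.+1 N (fun m => Bhat N r q (i + m%:Z) 0)
       * mx22 0 0 (s (i + l%:Z)) (- z (i + l%:Z))
       * mxprod 0 l (fun m => Bhat N r q (i + m%:Z) 0)).

Definition Cmx N r q s z i (lambda : R) : 'M[R]_2 :=
  alpha N r (i - 1) *: Dmx N r q s z i + alpha N r (i - 1) *: Chat N r q i lambda.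

Definition hfun N r q s z i (lambda : R) : R := - discr (Cmx N r q s z i lambda).

Definition Iset N r q s z : set R := [set lambda | hfun N r q s z 0 lambda <= 0].

Definition Lambda N r q s z : set R := ~` Iset N r q s z.

End Definitions.

(* Main.v *)
Require Import Defs.
From HB Require Import structures.
From mathcomp Require Import all_boot all_order all_algebra.
From mathcomp Require Import all_classical all_reals all_analysis.
From mathcomp Require Import ring lra zify.

Set Implicit Arguments.
Unset Strict Implicit.
Unset Printing Implicit Defensive.

Import Order.TTheory GRing.Theory Num.Theory.
Import numFieldNormedType.Exports.

Local Open Scope classical_set_scope.
Local Open Scope ring_scope.

(** The coefficients behave like those of an N-periodic problem whose
    monodromy matrix is gamma Id, so that over one period starting at
    m = N + k N a generalised eigenvector is multiplied by
        X_k(x) = gamma Id + R_k(x) / A_k,      A_k = a_(m - 1),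
    where gamma Id accounts for no growth at all and everything happens in the
    matrices R_k.  Expanding the product of one-step matrices to first order
    (mxprod_perturb) expresses R_k through 1/a, r a - a and b - q a along
    residue classes modulo N; hence R_k has summable variation in k, uniformly
    for bounded x, and its limit is the matrix C_0(x) of the definition of h_0
    (Cmx_firstord, mubv_Rmx).

    The estimate.  Let y_k = (u_(m-1), u_m) and let c_R(y) = det [y | R y].
    Since R_k commutes with X_k and X_k^T J X_k = (det X_k) J with
    det X_k = A_k / A_(k+1), the shifted Turan determinants
    Q_k = A_k c_(R_k)(y_k) satisfy
        Q_(k+1) - Q_k = A_(k+1) c_(R_(k+1) - R_k)(y_(k+1))     (turan_step).
    The discriminant of the binary quadratic form c_R is discr R.  On a compact
    subset K of Lambda, h_0 = - discr C_0 is bounded below by a positive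
    constant, and so is - discr R_k for all large k; there |Q_k| is comparable
    with A_k |y_k|^2 (crossform_coercive, crossform_bound), and the identity
    becomes |Q_(k+1) - Q_k| <= eta_k |Q_(k+1)| with eta summable and
    independent of x and u.  A Gronwall argument (gronwall_comparable) makes
    all the |Q_k| with k large comparable.  The indices in between, and the
    finitely many initial ones, cost only bounded factors (energy_step,
    fill_gaps).

    The interval.  C_0(x) = D + x T, where T is the derivative at 0 of the
    monodromy matrix of the periodic problem.  Up to the factor gamma, T is
    a sum of conjugates of a nilpotent matrix that corresponds to rank-one
    semidefinite quadratic forms, two of which are independent, so
    discr T < 0 (discr_derivative_lt0).  Therefore h_0 is a quadratic polynomial
    with positive leading coefficient; at the zero of the upper right
    entry of C_0 it equals minus a square, so {h_0 <= 0} is a nonempty compact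
    interval. *)

(** * Two-by-two matrices and their ordered products *)

Section Matrices.
Variable R : realType.
Implicit Types (A B : 'M[R]_2) (M F : nat -> 'M[R]_2).

Lemma ord2_cases (i : 'I_2) : i = 0 \/ i = 1.
Proof. by case: i => [[|[|//]] li]; [left|right]; apply/val_inj. Qed.

Lemma eq_mx22 A B : A 0 0 = B 0 0 -> A 0 1 = B 0 1 ->
  A 1 0 = B 1 0 -> A 1 1 = B 1 1 -> A = B.
Proof.
move=> h00 h01 h10 h11; apply/matrixP => i j.
by case: (ord2_cases i) => ->; case: (ord2_cases j) => ->.
Qed.

Lemma mul22E A B i j : (A * B) i j = A i 0 * B 0 j + A i 1 * B 1 j.
Proof.
rewrite mxE big_ord_recl big_ord1; congr (_ + A i _ * B _ j); exact/val_inj.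
Qed.

Lemma add22E A B i j : (A + B) i j = A i j + B i j.
Proof. by rewrite mxE. Qed.

Lemma scale22E (c : R) A i j : (c *: A) i j = c * A i j.
Proof. by rewrite mxE. Qed.

Lemma mx22E (c00 c01 c10 c11 : R) (C := mx22 c00 c01 c10 c11) :
  (C 0 0 = c00) * (C 0 1 = c01) * (C 1 0 = c10) * (C 1 1 = c11).
Proof. by rewrite /C !mxE. Qed.

Lemma scalar22E (c : R) (C : 'M[R]_2 := c%:M) :
  (C 0 0 = c) * (C 0 1 = 0) * (C 1 0 = 0) * (C 1 1 = c).
Proof. by rewrite /C !mxE /= !mulr1n !mulr0n. Qed.

Lemma one22E (C : 'M[R]_2 := 1) :
  (C 0 0 = 1) * (C 0 1 = 0) * (C 1 0 = 0) * (C 1 1 = 1).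
Proof. by rewrite /C !mxE. Qed.

Lemma det22E A : \det A = A 0 0 * A 1 1 - A 0 1 * A 1 0.
Proof.
have e1 : lift ord0 ord0 = 1 :> 'I_2 by exact/val_inj.
have e0 : lift 1 0 = 0 :> 'I_2 by exact/val_inj.
rewrite (expand_det_row A 0) big_ord_recl big_ord1 /cofactor !det_mx11 !mxE e1 e0.
by rewrite /= addn0 add0n expr0 expr1 mul1r mulN1r mulrN.
Qed.

Lemma discr22E A : discr A = (A 0 0 - A 1 1) ^+ 2 + 4 * A 0 1 * A 1 0.
Proof.
rewrite /discr /mxtrace big_ord_recl big_ord1 det22E.
have -> : lift ord0 ord0 = 1 :> 'I_2 by exact/val_inj.
by ring.
Qed.

Lemma mxprod_id m M : mxprod m m M = 1.
Proof. by rewrite /mxprod /index_iota subnn big_nil. Qed.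

Lemma mxprod_recr m n M : (m <= n)%N -> mxprod m n.+1 M = M n * mxprod m n M.
Proof.
move=> mn; rewrite /mxprod.
have -> : index_iota m n.+1 = rcons (index_iota m n) n.
  by rewrite /index_iota subSn// -addn1 iotaD subnKC// cats1.
by rewrite rev_rcons big_cons.
Qed.

Lemma eq_mxprod m n M M' : (forall l, (m <= l < n)%N -> M l = M' l) ->
  mxprod m n M = mxprod m n M'.
Proof.
move=> e; rewrite /mxprod big_seq_cond [RHS]big_seq_cond; apply: eq_bigr => l.
by rewrite mem_rev mem_index_iota andbT => /e.
Qed.

(** The coefficient of e in the product of the M l + e F l, where all the
    terms of higher order are kept inside the coefficient (mxprod_perturb).
    The same recursion thus gives an exact remainder for e <> 0 and the
    derivative of the product for e = 0. *)
Fixpoint firstord (e : R) M F (n : nat) : 'M[R]_2 :=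
  if n is l.+1 then
    (M l + e *: F l) * firstord e M F l + F l * mxprod 0 l M
  else 0.

Lemma mxprod_perturb e M F n :
  mxprod 0 n (fun l => M l + e *: F l) = mxprod 0 n M + e *: firstord e M F n.
Proof.
elim: n => [|n IH]; first by rewrite !mxprod_id /= scaler0 addr0.
rewrite !mxprod_recr// IH /= mulrDr mulrDl scalerDr -!addrA; congr (_ + _).
by rewrite addrC -scalerAr -scalerAl.
Qed.

Lemma firstord0E M F n : firstord 0 M F n =
  \sum_(0 <= l < n) mxprod l.+1 n M * F l * mxprod 0 l M.
Proof.
elim: n => [|n IH]; first by rewrite big_nil.
rewrite big_nat_recr//= scale0r addr0 mxprod_id mul1r IH; congr (_ + _).
rewrite mulr_sumr !big_seq; apply: eq_bigr => l.
by rewrite mem_index_iota => /andP[_ ln]; rewrite mxprod_recr// !mulrA.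
Qed.

Lemma firstord0_lin (c d : R) M F G n :
  firstord 0 M (fun l => c *: F l + d *: G l) n =
  c *: firstord 0 M F n + d *: firstord 0 M G n.
Proof.
rewrite !firstord0E !scaler_sumr -big_split; apply: eq_bigr => l _ /=.
by rewrite mulrDr mulrDl -!scalerAr -!scalerAl.
Qed.

Lemma eq_firstord e M F M' F' n : (forall l, (l < n)%N -> M l = M' l) ->
  (forall l, (l < n)%N -> F l = F' l) -> firstord e M F n = firstord e M' F' n.
Proof.
elim: n => //= n IH eM eF; rewrite eM// eF// IH; last 2 first.
- by move=> l ln; apply: eM; apply: ltnW.
- by move=> l ln; apply: eF; apply: ltnW.
congr (_ + _ * _); apply: eq_mxprod => l /= ln; apply: eM; exact: ltnW.
Qed.

Lemma det_mxprod M m n : (m <= n)%N -> \det (mxprod m n M) = \prod_(m <= l < n) \det (M l).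
Proof.
move=> mn; rewrite -(subnKC mn); elim: (n - m)%N => [|k IH].
  by rewrite addn0 mxprod_id det1 big_geq.
by rewrite addnS mxprod_recr ?leq_addr// big_nat_recr ?leq_addr//= det_mulmx IH mulrC.
Qed.

End Matrices.

(** * Uniformly bounded variation *)

Section UniformVariation.
Variables (R : realType) (K : set R).
Implicit Types (F : nat -> R -> R) (f : R -> R) (e : nat -> R).

(** For nonnegative terms this is convergence of the series. *)
Definition bounded_series e := exists B, forall n, \sum_(0 <= k < n) e k <= B.

(** The sequence F k converges to f on K, with increments dominated there by a
    single convergent series.  Such sequences form an algebra, and their
    convergence is uniform on K. *)
Definition ubv F f := exists e B, [/\ (forall k, 0 <= e k), bounded_series e,
  (forall k x, K x -> `|F k.+1 x - F k x| <= e k),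
  (forall k x, K x -> `|F k x| <= B) &
  forall x, K x -> F k x @[k --> \oo] --> f x].

Lemma bounded_series_tail e : (forall k, 0 <= e k) -> bounded_series e ->
  forall eps, 0 < eps ->
  exists k0, forall k m, (k0 <= k)%N -> \sum_(0 <= i < m) e (k + i)%N <= eps.
Proof.
move=> e0 [B hB] eps eps0.
pose U := [set y | exists n, y = \sum_(0 <= k < n) e k].
have sU : has_sup U.
  by split; [exists 0, 0%N; rewrite big_geq | exists B => _ [n ->]; exact: hB].
have [_ [k0 ->] hk0] := sup_adherent eps0 sU.
exists k0 => k m k0k.
have : \sum_(0 <= i < k + m) e i <= sup U.
  by have [_ ubU] := sU; apply: ub_le_sup => //; exists (k + m)%N.
rewrite (big_cat_nat _ (n := k)) ?leq_addr//=.
rewrite (big_cat_nat _ (n := k0) (p := k))//=.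
have -> : \sum_(k <= i < k + m) e i = \sum_(0 <= i < m) e (k + i)%N.
  by rewrite -{1}[k]add0n big_addn addKn; apply: eq_bigr => i _; rewrite addnC.
have : 0 <= \sum_(k0 <= i < k) e i by rewrite sumr_ge0.
by move=> *; lra.
Qed.

Lemma eq_ubv F G f g : (forall k x, K x -> F k x = G k x) -> (forall x, K x -> f x = g x) ->
  ubv F f -> ubv G g.
Proof.
move=> eF ef [e [B [e0 se d b c]]]; exists e, B; split=> //.
- by move=> k x Kx; rewrite -!eF//; exact: d.
- by move=> k x Kx; rewrite -!eF//; exact: b.
- move=> x Kx; rewrite -ef//; under eq_fun do rewrite -eF//; exact: c.
Qed.

Lemma ubv_seq (h : nat -> R) (l : R) : bounded_series (fun k => `|h k.+1 - h k|) ->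
  h k @[k --> \oo] --> l -> ubv (fun k _ => h k) (fun _ => l).
Proof.
move=> sh hl.
have [B hB] : exists B, forall k, `|h k| <= B.
  have [M [_ hM]] := cvg_seq_bounded (cvgP _ hl).
  by exists (M + 1) => k; apply: hM => //; rewrite ltrDl.
by exists (fun k => `|h k.+1 - h k|), B; split.
Qed.

Lemma ubv_param (g : R -> R) (B : R) : (forall x, K x -> `|g x| <= B) ->
  ubv (fun _ => g) g.
Proof.
move=> gB; exists (fun=> 0), B; split=> //.
- by exists 0 => n; rewrite big1.
- by move=> k x _; rewrite subrr normr0.
- by move=> x _; exact: cvg_cst.
Qed.

Lemma ubv_cst (c : R) : ubv (fun _ _ => c) (fun=> c).
Proof. exact: (@ubv_param _ `|c|). Qed.

Lemma ubvD F G f g : ubv F f -> ubv G g ->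
  ubv (fun k x => F k x + G k x) (fun x => f x + g x).
Proof.
move=> [e [B [e0 [Se hSe] d b c]]] [e' [B' [e0' [Se' hSe'] d' b' c']]].
exists (fun k => e k + e' k), (B + B'); split.
- by move=> k; rewrite addr_ge0.
- by exists (Se + Se') => n; rewrite big_split lerD.
- move=> k x Kx; rewrite opprD addrACA.
  by apply: (le_trans (ler_normD _ _)); rewrite lerD ?d ?d'.
- by move=> k x Kx; apply: (le_trans (ler_normD _ _)); rewrite lerD ?b ?b'.
- by move=> x Kx; apply: cvgD; [exact: c | exact: c'].
Qed.

(** F' G' - F G = F' (G' - G) + G (F' - F), with F' and G bounded. *)
Lemma ubvM F G f g : ubv F f -> ubv G g ->
  ubv (fun k x => F k x * G k x) (fun x => f x * g x).
Proof.
move=> [e [B [e0 [Se hSe] d b c]]] [e' [B' [e0' [Se' hSe'] d' b' c']]].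
exists (fun k => `|B| * e' k + `|B'| * e k), (`|B| * `|B'|); split.
- by move=> k; rewrite addr_ge0// mulr_ge0.
- exists (`|B| * Se' + `|B'| * Se) => n; rewrite big_split -!mulr_sumr.
  by rewrite lerD// ler_wpM2l.
- move=> k x Kx.
  have -> : F k.+1 x * G k.+1 x - F k x * G k x =
    F k.+1 x * (G k.+1 x - G k x) + G k x * (F k.+1 x - F k x) by ring.
  apply: (le_trans (ler_normD _ _)); rewrite !normrM lerD// ler_pM//.
  + exact: le_trans (b _ _ Kx) (ler_norm _).
  + exact: d'.
  + exact: le_trans (b' _ _ Kx) (ler_norm _).
  + exact: d.
- move=> k x Kx; rewrite normrM ler_pM//.
    exact: le_trans (b _ _ Kx) (ler_norm _).
  exact: le_trans (b' _ _ Kx) (ler_norm _).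
- by move=> x Kx; apply: cvgM; [exact: c | exact: c'].
Qed.

Lemma ubvZ (c : R) F f : ubv F f -> ubv (fun k x => c * F k x) (fun x => c * f x).
Proof. exact: ubvM (ubv_cst c). Qed.

Lemma ubvB F G f g : ubv F f -> ubv G g ->
  ubv (fun k x => F k x - G k x) (fun x => f x - g x).
Proof.
move=> hF hG; apply: (eq_ubv _ _ (ubvD hF (ubvZ (-1) hG))) => [k|] x _ //=;
  by rewrite mulN1r.
Qed.

(** The tail of the dominating series controls F k x - f x uniformly in x. *)
Lemma ubv_ge F f (delta : R) : 0 < delta -> ubv F f -> (forall x, K x -> delta <= f x) ->
  exists k0, forall k x, K x -> (k0 <= k)%N -> delta / 2 <= F k x.
Proof.
move=> delta0 [e [B [e0 se d b c]]] fd.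
have d2 : 0 < delta / 2 by lra.
have [k0 hk0] := bounded_series_tail e0 se d2; exists k0 => k x Kx k0k.
suff below m : F (k + m)%N x - delta / 2 <= F k x.
  have : f x - delta / 2 <= F k x.
    apply: (@cvgr_to_le _ \oo _ _ (fun m => F (k + m)%N x - delta / 2)).
      apply: cvgB; last exact: cvg_cst.
      move: (c x Kx); rewrite -(cvg_shiftn k).
      by under eq_fun do rewrite addnC.
    exact: nearW.
  have := fd x Kx; lra.
apply: (@le_trans _ _ (F (k + m)%N x - \sum_(0 <= i < m) e (k + i)%N)).
  by rewrite lerB// hk0.
rewrite lerBlDl -lerBlDr; elim: m => [|m IH]; first by rewrite addn0 subrr big_geq.
rewrite addnS big_nat_recr//=.
by have := d (k + m)%N x Kx; rewrite ler_norml => /andP[_]; lra.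
Qed.

End UniformVariation.

Section MatrixVariation.
Variables (R : realType) (K : set R).
Implicit Types (F : nat -> R -> 'M[R]_2) (f : R -> 'M[R]_2).

Definition mubv F f := forall i j, ubv K (fun k x => F k x i j) (fun x => f x i j).

Lemma mubv_cst (A : 'M[R]_2) : mubv (fun _ _ => A) (fun=> A).
Proof. by move=> i j; exact: ubv_cst. Qed.

Lemma mubvD F G f g : mubv F f -> mubv G g ->
  mubv (fun k x => F k x + G k x) (fun x => f x + g x).
Proof.
by move=> hF hG i j; apply: (eq_ubv _ _ (ubvD (hF i j) (hG i j))) => [k|] x _; rewrite mxE.
Qed.

Lemma mubvM F G f g : mubv F f -> mubv G g ->
  mubv (fun k x => F k x * G k x) (fun x => f x * g x).
Proof.
move=> hF hG i j.
apply: (eq_ubv _ _ (ubvD (ubvM (hF i 0) (hG 0 j)) (ubvM (hF i 1) (hG 1 j)))) => [k|] x _;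
  by rewrite mul22E.
Qed.

Lemma mubvZ (c : nat -> R -> R) (d : R -> R) F f : ubv K c d -> mubv F f ->
  mubv (fun k x => c k x *: F k x) (fun x => d x *: f x).
Proof.
by move=> hc hF i j; apply: (eq_ubv _ _ (ubvM hc (hF i j))) => [k|] x _; rewrite mxE.
Qed.

(** The factors e k F k l in the recursion tend to 0, so only the terms of order
    zero in e survive in the limit. *)
Lemma mubv_firstord (e : nat -> R) (M : nat -> 'M[R]_2)
    (F : nat -> R -> nat -> 'M[R]_2) (f : R -> nat -> 'M[R]_2) n :
  ubv K (fun k _ => e k) (fun=> 0) ->
  (forall l, (l < n)%N -> mubv (fun k x => F k x l) (fun x => f x l)) ->
  mubv (fun k x => firstord (e k) M (F k x) n) (fun x => firstord 0 M (f x) n).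
Proof.
move=> he; elim: n => [|n IH] hF /=; first exact: mubv_cst.
have Fn := hF n (ltnSn n).
apply: mubvD; apply: mubvM.
- by apply: mubvD; [exact: mubv_cst | apply: mubvZ].
- by apply: IH => l /leqW/hF.
- exact: Fn.
- exact: mubv_cst.
Qed.

Lemma mubv_unif F f : mubv F f -> exists e B, [/\ (forall k, 0 <= e k), bounded_series e,
  (forall k x i j, K x -> `|(F k.+1 x - F k x) i j| <= e k) &
  (forall k x i j, K x -> `|F k x i j| <= B)].
Proof.
move=> hF.
have [e1 [B1 [p1 [S1 s1] d1 b1 _]]] := hF 0 0.
have [e2 [B2 [p2 [S2 s2] d2 b2 _]]] := hF 0 1.
have [e3 [B3 [p3 [S3 s3] d3 b3 _]]] := hF 1 0.
have [e4 [B4 [p4 [S4 s4] d4 b4 _]]] := hF 1 1.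
exists (fun k => e1 k + e2 k + e3 k + e4 k), (`|B1| + `|B2| + `|B3| + `|B4|); split.
- by move=> k; rewrite !addr_ge0.
- by exists (S1 + S2 + S3 + S4) => n; rewrite !big_split !lerD.
- move=> k x i j Kx; rewrite mxE [X in _ + X]mxE.
  have := (p1 k, p2 k, p3 k, p4 k); move=> [[[q1 q2] q3] q4].
  by case: (ord2_cases i) => ->; case: (ord2_cases j) => ->;
    [have := d1 k x Kx|have := d2 k x Kx|have := d3 k x Kx|have := d4 k x Kx] => ?; lra.
- move=> k x i j Kx.
  have := (normr_ge0 B1, normr_ge0 B2, normr_ge0 B3, normr_ge0 B4).
  have := (ler_norm B1, ler_norm B2, ler_norm B3, ler_norm B4).
  move=> [[[q1 q2] q3] q4] [[[t1 t2] t3] t4].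
  by case: (ord2_cases i) => ->; case: (ord2_cases j) => ->;
    [have := b1 k x Kx|have := b2 k x Kx|have := b3 k x Kx|have := b4 k x Kx] => ?; lra.
Qed.

End MatrixVariation.

(** * Residue classes of the index *)

Lemma lt_pinfty_add3 (R : realType) (x y t : \bar R) :
  (0 <= x)%E -> (0 <= y)%E -> (0 <= t)%E -> (x + y + t < +oo)%E ->
  [/\ (x < +oo)%E, (y < +oo)%E & (t < +oo)%E].
Proof.
move=> x0 y0 t0 h; split; apply: le_lt_trans h.
- by rewrite -addeA leeDl// adde_ge0.
- by rewrite addeAC leeDr// adde_ge0.
- by rewrite leeDr// adde_ge0.
Qed.

Section Residues.
Variables (R : realType) (N : nat).
Hypothesis N_gt0 : (0 < N)%N.

Lemma periodicM (f : int -> R) m k : nperiodic N f -> f (m + k * N)%N%:Z = f m%:Z.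
Proof.
move=> fN; elim: k => [|k IH]; first by rewrite addn0.
rewrite -IH -[RHS]fN; congr f; lia.
Qed.

Lemma nperiodic_bounded (f : int -> R) : nperiodic N f ->
  exists B, forall n : nat, `|f n%:Z| <= B.
Proof.
move=> fN; exists (\sum_(l < N) `|f l%:Z|) => n.
rewrite (divn_eq n N) addnC periodicM//.
by rewrite (bigD1 (Ordinal (ltn_pmod n N_gt0)))//= lerDl sumr_ge0.
Qed.

Lemma cvg_residue (T : topologicalType) (F : set_system T) (u : nat -> T) (m : nat) :
  u n @[n --> \oo] --> F -> u (m + k * N)%N @[k --> \oo] --> F.
Proof.
apply: cvg_comp => A [n _ nA]; exists n => // k /= nk; apply: nA => /=.
by apply: (leq_trans nk); rewrite (leq_trans (leq_pmulr _ N_gt0))// leq_addl.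
Qed.

Lemma Nvariation_ge0 m (x : nat -> R) : (0 <= Nvariation N m x)%E.
Proof. by apply: nneseries_ge0 => n _ _; rewrite lee_fin. Qed.

Lemma Nvariation_bounded m (x : nat -> R) : (Nvariation N m x < +oo)%E ->
  exists B, forall n, \sum_(m <= i < n) `|x (i + N)%N - x i| <= B.
Proof.
move=> xoo; exists (fine (Nvariation N m x)) => n.
have t0 i : (0 <= `|x (i + N)%N - x i|%:E)%E by rewrite lee_fin.
have V0 : (0 <= Nvariation N m x)%E by apply: nneseries_ge0.
rewrite -lee_fin fineK; last by rewrite ge0_fin_numE.
by rewrite -sumEFin; apply: nneseries_lim_ge.
Qed.

(** Consecutive terms along a residue class modulo N are at distance N, so the
    variation along the class is a part of the total N-variation. *)
Lemma ubv_residue (K : set R) m m0 (x : nat -> R) (l : R) :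
  (Nvariation N m x < +oo)%E -> (m <= m0)%N ->
  x (m0 + k * N)%N @[k --> \oo] --> l ->
  ubv K (fun k _ => x (m0 + k * N)%N) (fun=> l).
Proof.
move=> /Nvariation_bounded[B hB] mm0; apply: ubv_seq; exists B => n.
apply: le_trans (hB (m0 + n * N)%N).
have le0 : forall i, 0 <= `|x (i + N)%N - x i| by [].
rewrite [leRHS](big_cat_nat _ (n := m0)) ?leq_addr//=.
apply: (@le_trans _ _ (\sum_(m0 <= i < m0 + n * N) `|x (i + N)%N - x i|)); last first.
  by rewrite lerDr sumr_ge0.
elim: n => [|n IH]; first by rewrite big_geq// sumr_ge0.
rewrite big_nat_recr//= [leRHS](big_cat_nat _ (n := (m0 + n * N)%N)) ?leq_addr ?leq_add2l ?leq_mul//=.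
rewrite lerD// big_ltn; last by rewrite ltn_add2l ltn_pmul2r.
have -> : (m0 + n.+1 * N = m0 + n * N + N)%N by lia.
by rewrite lerDl sumr_ge0.
Qed.

End Residues.

(** * Elementary inequalities *)

Section Elementary.
Variable R : realType.

Lemma quadratic_le0_itv (h : R -> R) (A B C x0 : R) :
  (forall x, h x = A * x ^+ 2 + B * x + C) -> 0 < A -> h x0 <= 0 ->
  exists c d : R, c <= d /\ [set x | h x <= 0] = `[c, d]%classic.
Proof.
move=> hE A0 h0.
have D0 : 0 <= B ^+ 2 - 4 * A * C.
  have -> : B ^+ 2 - 4 * A * C = (2 * A * x0 + B) ^+ 2 - 4 * A * h x0.
    by rewrite hE; ring.
  by rewrite subr_ge0 (le_trans _ (sqr_ge0 _))// pmulr_rle0// mulr_gt0.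
set S := Num.sqrt (B ^+ 2 - 4 * A * C).
have S0 : 0 <= S by exact: sqrtr_ge0.
have SE : S ^+ 2 = B ^+ 2 - 4 * A * C by rewrite sqr_sqrtr.
have A2 : 0 < 2 * A by rewrite mulr_gt0.
exists ((- B - S) / (2 * A)), ((- B + S) / (2 * A)); split.
  by rewrite ler_pM2r ?invr_gt0//; lra.
apply/seteqP; split => x /=; rewrite in_itv/= ler_pdivrMr// ler_pdivlMr//.
- move=> hx; have : (x * (2 * A) + B) ^+ 2 <= S ^+ 2.
    rewrite SE; have -> : (x * (2 * A) + B) ^+ 2 = 4 * A * h x + (B ^+ 2 - 4 * A * C).
      by rewrite hE; ring.
    by rewrite gerDr pmulr_rle0// mulr_gt0.
  rewrite -(real_normK (num_real (_ + B))) ler_sqr ?nnegrE// ler_norml => /andP[? ?].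
  by apply/andP; split; lra.
- move=> /andP[h1 h2].
  have : (x * (2 * A) + B) ^+ 2 <= S ^+ 2.
    by rewrite -(real_normK (num_real (_ + B))) ler_sqr ?nnegrE// ler_norml; apply/andP; split; lra.
  rewrite SE -subr_le0.
  have -> : (x * (2 * A) + B) ^+ 2 - (B ^+ 2 - 4 * A * C) = 4 * A * h x.
    by rewrite hE; ring.
  by rewrite pmulr_rle0// mulr_gt0.
Qed.

Lemma quadratic_compact_lower_bound (A B C : R) (K : set R) (h : R -> R) :
  (forall x, h x = A * x ^+ 2 + B * x + C) -> compact K -> (forall x, K x -> 0 < h x) ->
  exists2 delta, 0 < delta & forall x, K x -> delta <= h x.
Proof.
move=> hE cK hK; have [K0|/set0P[x0 Kx0]] := eqVneq K set0.
  by exists 1 => // x; rewrite K0.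
have hc : continuous h.
  have -> : h = (fun x => A * x ^+ 2 + B * x + C) by apply/funext.
  move=> x; apply: cvgD; last exact: cvg_cst.
  apply: cvgD; first by apply: cvgM; [exact: cvg_cst | exact: exprn_continuous].
  by apply: cvgM; [exact: cvg_cst | exact: cvg_id].
have [] := @compact_EVT_min _ _ h K _ cK (continuous_subspaceT hc); first by exists x0.
move=> c; rewrite inE => Kc hmin; exists (h c); first exact: hK.
by move=> x Kx; apply: hmin; rewrite inE.
Qed.

(** The determinant of the matrix with columns v and A v, where v = (x, y). *)
Definition crossform (A : 'M[R]_2) (x y : R) : R :=
  A 1 0 * x ^+ 2 + (A 1 1 - A 0 0) * x * y - A 0 1 * y ^+ 2.

(** X commutes with A, so the columns X v and A X v are the images under X of
    v and A v. *)
Lemma crossform_transport (A : 'M[R]_2) (g e x y : R) (X := g%:M + e *: A) :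
  crossform A (X 0 0 * x + X 0 1 * y) (X 1 0 * x + X 1 1 * y) =
  \det X * crossform A x y.
Proof.
by rewrite det22E /crossform /X !mxE /= !mulr1n !mulr0n; ring.
Qed.

Lemma crossformB (A B : 'M[R]_2) x y :
  crossform (A - B) x y = crossform A x y - crossform B x y.
Proof. by rewrite /crossform !mxE; ring. Qed.

Lemma crossform_bound (A : 'M[R]_2) (B x y : R) : (forall i j, `|A i j| <= B) ->
  `|crossform A x y| <= 2 * B * (x ^+ 2 + y ^+ 2).
Proof.
move=> hB.
have bnd (c t : R) : `|c| <= B -> 0 <= t -> `|c * t| <= B * t.
  by move=> cB t0; rewrite normrM (ger0_norm t0) ler_wpM2r.
have -> : crossform A x y = A 1 0 * x ^+ 2 + A 1 1 * (x * y) - A 0 0 * (x * y)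
   - A 0 1 * y ^+ 2 by rewrite /crossform; ring.
have B0 : 0 <= B by apply: le_trans (hB 0 0).
have xy : `|x * y| <= (x ^+ 2 + y ^+ 2) / 2.
  have := sqr_ge0 (x - y); have := sqr_ge0 (x + y); rewrite ler_norml => *.
  by apply/andP; split; nra.
have := bnd _ _ (hB 1 0) (sqr_ge0 x); have := bnd _ _ (hB 0 1) (sqr_ge0 y).
have m i j : `|A i j * (x * y)| <= B * ((x ^+ 2 + y ^+ 2) / 2).
  by rewrite normrM ler_pM.
have := m 0 0; have := m 1 1; rewrite !ler_norml.
move=> /andP[? ?] /andP[? ?] /andP[? ?] /andP[? ?].
by apply/andP; split; lra.
Qed.

(** Complete the square: multiplied by four times one of its extreme
    coefficients, the form is a square plus - discr A times the square of the
    other variable. *)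
Lemma crossform_coercive (A : 'M[R]_2) (B delta x y : R) :
  (forall i j, `|A i j| <= B) -> delta <= - discr A -> 0 <= delta ->
  delta * (x ^+ 2 + y ^+ 2) <= 8 * B * `|crossform A x y|.
Proof.
move=> hB; rewrite discr22E => hd d0.
set Q := crossform A x y.
have half c t : `|c| <= B -> delta * t ^+ 2 <= 4 * c * Q -> delta * t ^+ 2 <= 4 * B * `|Q|.
  move=> cB /le_trans; apply; rewrite -!mulrA ler_pM2l//.
  by apply: (le_trans (ler_norm _)); rewrite normrM ler_wpM2r.
have h1 : delta * y ^+ 2 <= 4 * B * `|Q|.
  apply: (half _ _ (hB 1 0)).
  have -> : 4 * A 1 0 * Q = (2 * A 1 0 * x + (A 1 1 - A 0 0) * y) ^+ 2
    + (- ((A 0 0 - A 1 1) ^+ 2 + 4 * A 0 1 * A 1 0)) * y ^+ 2.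
    by rewrite /Q /crossform; ring.
  by rewrite ler_wpDl ?sqr_ge0// ler_wpM2r ?sqr_ge0.
have h2 : delta * x ^+ 2 <= 4 * B * `|Q|.
  apply: (half (- A 0 1)); first by rewrite normrN.
  have -> : 4 * (- A 0 1) * Q = (2 * A 0 1 * y - (A 1 1 - A 0 0) * x) ^+ 2
    + (- ((A 0 0 - A 1 1) ^+ 2 + 4 * A 0 1 * A 1 0)) * x ^+ 2.
    by rewrite /Q /crossform; ring.
  by rewrite ler_wpDl ?sqr_ge0// ler_wpM2r ?sqr_ge0.
lra.
Qed.

Lemma common_bound (t : seq R) : exists2 B, 1 <= B & forall x, x \in t -> x <= B.
Proof.
exists (1 + \sum_(x <- t) `|x|); first by rewrite lerDl sumr_ge0.
move=> x xt; apply: (le_trans (ler_norm _)).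
by rewrite (big_rem _ xt)/= addrCA lerDl addr_ge0// sumr_ge0.
Qed.

(** Solving the three-term recurrence for either of its outer terms w costs a
    factor that depends only on the ratios of the coefficients. *)
Lemma solve_bound (C p c d w y t : R) : 0 < p -> 0 <= C -> p * w = c * y - d * t ->
  `|c| <= C * p -> `|d| <= C * p -> w ^+ 2 <= 2 * C ^+ 2 * (y ^+ 2 + t ^+ 2).
Proof.
move=> p0 C0 e hc hd.
have hw : `|w| <= C * (`|y| + `|t|).
  rewrite -(ler_pM2l p0) -{1}(gtr0_norm p0) -normrM e.
  apply: (le_trans (ler_normB _ _)); rewrite !normrM.
  have := ler_wpM2r (normr_ge0 y) hc; have := ler_wpM2r (normr_ge0 t) hd; lra.
rewrite -(real_normK (num_real w)).
apply: (@le_trans _ _ ((C * (`|y| + `|t|)) ^+ 2)).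
  by rewrite ler_sqr ?nnegrE// mulr_ge0 ?addr_ge0.
have -> : 2 * C ^+ 2 * (y ^+ 2 + t ^+ 2) = C ^+ 2 * (2 * (y ^+ 2 + t ^+ 2)) by ring.
rewrite exprMn ler_wpM2l ?sqr_ge0//.
rewrite -(real_normK (num_real y)) -(real_normK (num_real t)).
have := sqr_ge0 (`|y| - `|t|); lra.
Qed.

(** Both 1 - eta and the inverse of 1 + eta are at least 1 - eta, and a product
    of factors 1 - eta_k is at least 1 minus the sum of the eta_k, hence at
    least 1/2. *)
Lemma gronwall_comparable (Q eta : nat -> R) :
  (forall k, 0 <= eta k) -> (forall m, \sum_(0 <= k < m) eta k <= 2^-1) ->
  (forall k, `|Q k.+1 - Q k| <= eta k * `|Q k.+1|) ->
  forall m, `|Q m| <= 2 * `|Q 0%N| /\ `|Q 0%N| <= 2 * `|Q m|.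
Proof.
move=> eta0 etaS step m.
suff [h1 h2] : (1 - \sum_(0 <= k < m) eta k) * `|Q m| <= `|Q 0%N| /\
    (1 - \sum_(0 <= k < m) eta k) * `|Q 0%N| <= `|Q m|.
  have := etaS m; have := normr_ge0 (Q m); have := normr_ge0 (Q 0%N).
  by move: h1 h2; set S := \sum_(_ <= _ < _) _; move=> *; split; nra.
elim: m => [|m [IH1 IH2]]; first by rewrite big_geq// subr0 mul1r.
rewrite big_nat_recr//=.
have := etaS m.+1; rewrite big_nat_recr//=.
have S0 : 0 <= \sum_(0 <= k < m) eta k by apply: sumr_ge0.
move: S0 IH1 IH2; set S := \sum_(_ <= _ < _) _ => S0 IH1 IH2 hS.
have u0 := normr_ge0 (Q m); have v0 := normr_ge0 (Q m.+1); have e0 := eta0 m.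
have t1 : `|Q m| <= (1 + eta m) * `|Q m.+1|.
  have := step m; have := ler_normB (Q m.+1) (Q m.+1 - Q m); rewrite opprB addrC subrK.
  by move=> *; lra.
have t2 : (1 - eta m) * `|Q m.+1| <= `|Q m|.
  have := step m; have := ler_normD (Q m.+1 - Q m) (Q m); rewrite subrK.
  by move=> *; lra.
move: (`|Q m|) (`|Q m.+1|) (`|Q 0|) (eta m) u0 v0 e0 t1 t2 IH1 IH2 hS.
move=> u v w e u0 v0 e0 t1 t2 IH1 IH2 hS; split.
- have -> : (1 - (S + e)) * v = (1 - S) * ((1 - e) * v) - S * e * v by ring.
  have : (1 - S) * ((1 - e) * v) <= (1 - S) * u by apply: ler_wpM2l => //; lra.
  have : 0 <= S * e * v by rewrite !mulr_ge0.
  by lra.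
- have w0 : 0 <= (1 - S) * w by nra.
  have a1 : (1 - e) * ((1 - S) * w) <= (1 - e) * u by apply: ler_wpM2l => //; lra.
  have a2 : (1 - e) * u <= (1 - e) * ((1 + e) * v) by apply: ler_wpM2l => //; lra.
  nra.
Qed.

(** Comparability along n0 + k N spreads to all indices: from the nearest such
    index below n at most N steps remain, and at most n0 steps
    lead from 1 to n0.  The constant Z depends only on L, W, n0 and N, not on the sequence. *)
Lemma fill_gaps (L W : R) (n0 N : nat) : 1 <= L -> 1 <= W -> (0 < n0)%N -> (0 < N)%N ->
  exists2 Z, 0 < Z & forall v : nat -> R, (forall n, 0 <= v n) ->
    (forall n, (0 < n)%N -> v n.+1 <= L * v n /\ v n <= L * v n.+1) ->
    (forall k, v (n0 + k * N)%N <= W * v n0 /\ v n0 <= W * v (n0 + k * N)%N) ->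
    forall n, (0 < n)%N -> v n <= Z * v 1%N /\ v 1%N <= Z * v n.
Proof.
move=> L1 W1 n0_gt0 N_gt0.
have L0 : 0 <= L by lra. have W0 : 0 <= W by lra.
exists (L ^+ N * W * L ^+ n0); first by rewrite !mulr_gt0 ?exprn_gt0//; lra.
move=> v v0 step per.
have comp m j : (0 < m)%N -> v (m + j)%N <= L ^+ j * v m /\ v m <= L ^+ j * v (m + j)%N.
  move=> m0; elim: j => [|j [IH1 IH2]]; first by rewrite addn0 expr0 mul1r.
  have [s1 s2] := step (m + j)%N (ltn_addr _ m0).
  rewrite addnS exprS; split.
    by apply: (le_trans s1); rewrite -mulrA ler_wpM2l.
  by apply: (le_trans IH2); rewrite [L * _]mulrC -mulrA ler_wpM2l// exprn_ge0.
have mono j j' (y : R) : (j <= j')%N -> 0 <= y -> L ^+ j * y <= L ^+ j' * y.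
  by move=> jj y0; rewrite ler_wpM2r// ler_weXn2l.
move=> n n_gt0; have [nn0|n0n] := leqP n n0.
  have [h1 h2] := comp 1%N n.-1 isT; rewrite add1n prednK// in h1 h2.
  have e : (n.-1 <= n0)%N by lia.
  have LW : 1 <= L ^+ N * W by rewrite mulr_ege1// exprn_ege1.
  have up y : 0 <= y -> L ^+ n.-1 * y <= L ^+ N * W * L ^+ n0 * y.
    move=> y0; apply: (le_trans (mono _ _ _ e y0)).
    by rewrite -mulrA ler_peMl// mulr_ge0// exprn_ge0.
  by split; [apply: (le_trans h1) | apply: (le_trans h2)]; apply: up.
set k := ((n - n0) %/ N)%N; set j := ((n - n0) %% N)%N.
have nE : n = (n0 + k * N + j)%N by have := divn_eq (n - n0) N; rewrite -/k -/j; lia.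
have jN : (j <= N)%N by rewrite ltnW// ltn_mod.
have [p1 p2] := per k.
have [h1 h2] := comp (n0 + k * N)%N j (ltn_addr _ n0_gt0); rewrite -nE in h1 h2.
have [g1 g2] := comp 1%N n0.-1 isT; rewrite add1n prednK// in g1 g2.
have [e0 e1] := (mono _ _ _ (leq_pred n0) (v0 1%N), mono _ _ _ (leq_pred n0) (v0 n0)).
have LN := exprn_ge0 N L0; have Ln0 := exprn_ge0 n0 L0.
rewrite -!mulrA; split.
  apply: (le_trans h1); apply: (le_trans (mono _ _ _ jN (v0 _))).
  rewrite ler_wpM2l//; apply: (le_trans p1); rewrite ler_wpM2l//.
  exact: le_trans g1 e0.
have f : v n0 <= W * (L ^+ N * v n).
  apply: (le_trans p2); rewrite ler_wpM2l//; apply: (le_trans h2); exact: mono.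
apply: (le_trans g2); apply: (le_trans e1).
have -> : L ^+ N * (W * (L ^+ n0 * v n)) = L ^+ n0 * (W * (L ^+ N * v n)) by ring.
by rewrite ler_wpM2l.
Qed.

End Elementary.

(** * The limit matrix and the sign of its discriminant *)

Section LimitMatrix.
Variables (R : realType) (N : nat) (r q : int -> R) (gamma : R).
Hypotheses (N_gt0 : (0 < N)%N) (gammaE : gamma = -1 \/ gamma = 1).
Hypothesis r_gt0 : forall l, (l < N)%N -> 0 < r l%:Z.

Let M (l : nat) : 'M[R]_2 := mx22 0 1 (- r l%:Z) (- q l%:Z).
Let P n := mxprod 0 n M.
Hypothesis prodE : P N = gamma%:M.

Let al (l : nat) := alpha N r l%:Z.
Let E (l : nat) : 'M[R]_2 := (al l)^-1 *: mx22 0 0 0 1.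
Let T n := firstord 0 M E n.

(** For N = 1 the upper right entry of the product is 1. *)
Lemma period_gt1 : (1 < N)%N.
Proof.
move: N_gt0 prodE; case: N => [//|[|//]] _.
rewrite /P mxprod_recr// mxprod_id mulr1 => /matrixP/(_ 0 1).
by rewrite /M mx22E scalar22E => /eqP; rewrite oner_eq0.
Qed.

Lemma gamma2 : gamma * gamma = 1.
Proof. by case: gammaE => ->; ring. Qed.

(** Both sides are the determinant of the monodromy matrix. *)
Lemma prod_r : \prod_(0 <= l < N) r l%:Z = 1.
Proof.
have := congr1 determinant prodE.
rewrite det_mxprod// det_scalar expr2 gamma2; apply: etrans; apply: eq_bigr => l _.
by rewrite det22E /M !mx22E; ring.
Qed.

Lemma alphaE l : (l < N)%N -> al l = \prod_(l.+1 <= m < N) r m%:Z.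
Proof. by move=> lN; rewrite /al /alpha /periodize modz_nat modn_small. Qed.

Lemma alpha_gt0 l : (l < N)%N -> 0 < al l.
Proof.
move=> lN; rewrite alphaE// big_seq; apply: prodr_gt0 => m.
by rewrite mem_index_iota => /andP[_]; exact: r_gt0.
Qed.

Lemma alphaN1 : alpha N r (- 1) = 1.
Proof.
rewrite /alpha /periodize -modzDr.
have -> : -1 + N%:Z = N.-1%:Z by lia.
by rewrite modz_nat modn_small ?prednK//= big_geq// prednK.
Qed.

Lemma alpha_pred l : (l < N)%N -> alpha N r (l%:Z - 1) = r l%:Z * al l.
Proof.
case: l => [|l] lN; first by rewrite sub0r alphaN1 alphaE// -big_ltn// prod_r.
have -> : l.+1%:Z - 1 = l%:Z by lia.
by rewrite (alphaE lN) -big_ltn// -alphaE// ltnW.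
Qed.

Lemma betaE l : (l < N)%N -> beta N r q l%:Z = al l * q l%:Z.
Proof. by move=> lN; rewrite /beta /periodize modz_nat modn_small. Qed.

Lemma Bhat0 l : (l < N)%N -> Bhat N r q l%:Z 0 = M l.
Proof.
move=> lN; have /lt0r_neq0 a0 := alpha_gt0 lN.
rewrite /Bhat alpha_pred// betaE// -/(al l) mulfK//.
by rewrite sub0r mulNr mulrAC mulfV// mul1r.
Qed.

Lemma PS n : P n.+1 = M n * P n. Proof. by rewrite /P mxprod_recr. Qed.

Lemma PSE n j : (P n.+1 0 j = P n 1 j) *
  (P n.+1 1 j = - r n%:Z * P n 0 j - q n%:Z * P n 1 j).
Proof. by rewrite PS !mul22E /M !mx22E; split; ring. Qed.

Lemma TSE n j : (T n.+1 0 j = T n 1 j) *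
  (T n.+1 1 j = - r n%:Z * T n 0 j - q n%:Z * T n 1 j + (al n)^-1 * P n 1 j).
Proof.
rewrite /T /= -/(T n) -/(P n) scale0r addr0.
by rewrite !add22E !mul22E /E /M !scale22E !mx22E; split; ring.
Qed.

(** A column of the partial products and of their derivatives obeys the
    recurrence of the polynomials p at 0, as the upper row of each product
    is the lower row of the preceding one. *)
Lemma three_term_row (p : nat -> {poly R}) (c : R) (j : 'I_2) :
  (forall n, p n.+2 = (alpha N r n.+1%:Z)^-1 *:
     (('X - (beta N r q n.+1%:Z)%:P) * p n.+1 - alpha N r (n.+1%:Z - 1) *: p n)) ->
  (forall n, (n < 2)%N -> P n 1 j = c * (p n).[0] /\ T n 1 j = c * (p n)^`().[0]) ->
  forall n, (n <= N)%N -> P n 1 j = c * (p n).[0] /\ T n 1 j = c * (p n)^`().[0].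
Proof.
move=> pS init.
suff H n : (n < N)%N -> (P n 1 j = c * (p n).[0] /\ T n 1 j = c * (p n)^`().[0]) /\
    (P n.+1 1 j = c * (p n.+1).[0] /\ T n.+1 1 j = c * (p n.+1)^`().[0]).
  by case=> [_|n /H[]//]; exact: init.
elim: n => [|n IH] nN; first by split; exact: init.
have [[P0 T0] [P1 T1]] := IH (ltnW nN); split; first by [].
have /lt0r_neq0 a0 := alpha_gt0 nN.
rewrite pS betaE// alpha_pred// -/(al n.+1) PSE TSE PSE TSE P0 P1 T0 T1.
rewrite !poly.derivE !(hornerE, hornerM) /=.
by split; field.
Qed.

(** The entries of the monodromy matrix are the polynomials w, and T N is its
    derivative at 0. *)
Lemma ChatE lambda : Chat N r q 0 lambda = lambda *: T N.
Proof.
have N2 := period_gt1; have /lt0r_neq0 a0 := alpha_gt0 N_gt0.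
set c := alpha N r (0 - 1) / alpha N r 0.
have cE : c = r 0 by rewrite /c (alpha_pred N_gt0) mulfK.
have p0 : P 0 = 1 by rewrite /P mxprod_id.
have H1 : forall n, (n <= N)%N -> P n 1 1 = 1 * (wpol N r q 0 n).[0] /\
    T n 1 1 = 1 * dw0 N r q 0 n.
  apply: three_term_row => [n|[|[|//]] _].
  - by rewrite /= addr0.
  - by rewrite p0 one22E /T /= mxE /dw0 !(poly.derivE, hornerE).
  - rewrite PSE TSE p0 !one22E /T /= !mxE betaE// !poly.derivE !hornerE /=.
    by rewrite -/(al 0) ; split; [field|ring].
(* The first column of P n involves the polynomials w^[1] of index n - 1, which
   vanish for n = 0. *)
pose v n := if n is m.+1 then wpol N r q 1 m else 0.
have H0 : forall n, (n <= N)%N -> P n 1 0 = - c * (v n).[0] /\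
    T n 1 0 = - c * (v n)^`().[0].
  apply: three_term_row => [[|n]|[|[|//]] _].
  - by rewrite /= scaler0 subr0 mulr1.
  - rewrite /v [wpol _ _ _ _ n.+2]/=.
    by have -> : n.+1%:Z + 1 = n.+2%:Z :> int by lia.
  - by rewrite p0 one22E /T /= mxE /v !(poly.derivE, hornerE) ?mulr0.
  - rewrite PSE TSE p0 !one22E /T /= !mxE !poly.derivE !hornerE /= cE.
    by split; ring.
rewrite /Chat add0r -/c; congr (_ *: _).
have vE n : (0 < n)%N -> v n = wpol N r q 1 (n - 1) by case: n => // n _; rewrite subn1.
have NE : N = (N - 2).+2 by lia.
have e1 : (N - 1)%N = (N - 2).+1 by lia.
apply: eq_mx22; rewrite mx22E.
- rewrite [in RHS]NE TSE (H0 (N - 2).+1 _).2//; lia.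
- rewrite [in RHS]NE TSE -e1 (H1 (N - 1)%N _).2 ?mul1r//; lia.
- by rewrite (H0 N _).2// vE.
- by rewrite (H1 N _).2// mul1r.
Qed.

Lemma CmxE (s z : int -> R) lambda : Cmx N r q s z 0 lambda =
  firstord 0 M (fun l => (al l)^-1 *: mx22 0 0 (s l%:Z) (- z l%:Z)) N + lambda *: T N.
Proof.
rewrite /Cmx sub0r alphaN1 !scale1r ChatE firstord0E /Dmx; congr (_ + _).
rewrite !big_seq; apply: eq_bigr => l; rewrite mem_index_iota => /andP[_ lN].
rewrite -scalerAr -scalerAl add0r; congr (_ *: (_ * _ * _)); apply: eq_mxprod => m /andP[_ mN].
- by rewrite add0r Bhat0.
- by rewrite add0r Bhat0// (ltn_trans mN).
Qed.

Lemma Cmx_firstord (s z : int -> R) lambda : Cmx N r q s z 0 lambda =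
  firstord 0 M (fun l => (al l)^-1 *: mx22 0 0 (s l%:Z) (lambda - z l%:Z)) N.
Proof.
rewrite CmxE -[X in X + _]scale1r /T -firstord0_lin; apply: eq_firstord => // l _.
by apply: eq_mx22; rewrite !mxE /=; ring.
Qed.

(** Let k n = adj(P n) T n.  Since adj(M n) maps (0, 1) to a multiple of (1, 0),
    each step adds to r n k n the traceless matrix -(1/alpha n) (cd, d^2;
    -c^2, -cd), where (c, d) is the lower row of P n.  With traceless
    matrices read as quadratic forms this is the semidefinite form of rank one
    attached to (c, d).  The rows (0, 1) and (-r 0, -q 0) of the first two steps
    are independent, so the form is definite from n = 2 on; at n = N the adjugate
    is gamma Id. *)
Lemma discr_derivative_lt0 : discr (T N) < 0.
Proof.
have N2 := period_gt1.
pose k00 n := P n 1 1 * T n 0 0 - P n 0 1 * T n 1 0.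
pose k01 n := P n 1 1 * T n 0 1 - P n 0 1 * T n 1 1.
pose k10 n := P n 0 0 * T n 1 0 - P n 1 0 * T n 0 0.
pose k11 n := P n 0 0 * T n 1 1 - P n 1 0 * T n 0 1.
have S n : [/\ k00 n.+1 = r n%:Z * k00 n - (al n)^-1 * (P n 1 0 * P n 1 1),
   k01 n.+1 = r n%:Z * k01 n - (al n)^-1 * P n 1 1 ^+ 2,
   k10 n.+1 = r n%:Z * k10 n + (al n)^-1 * P n 1 0 ^+ 2 &
   k11 n.+1 = r n%:Z * k11 n + (al n)^-1 * (P n 1 0 * P n 1 1)].
  by rewrite /k00 /k01 /k10 /k11 !PSE !TSE; split; ring.
have p0 : P 0 = 1 by rewrite /P mxprod_id.
have t0 : T 0 = 0 by [].
have inv n : (n.+2 <= N)%N -> [/\ k00 n.+2 + k11 n.+2 = 0, k01 n.+2 < 0 &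
    k00 n.+2 ^+ 2 < - k01 n.+2 * k10 n.+2].
  elim: n => [|n IH] nN.
    have [] := S 1%N; have [] := S 0%N; rewrite !PSE p0 !one22E.
    have -> : k00 0 = 0 by rewrite /k00 t0 !mxE; ring.
    have -> : k01 0 = 0 by rewrite /k01 t0 !mxE; ring.
    have -> : k10 0 = 0 by rewrite /k10 t0 !mxE; ring.
    have -> : k11 0 = 0 by rewrite /k11 t0 !mxE; ring.
    move=> -> -> -> -> -> -> -> ->.
    have r0 := r_gt0 N_gt0; have r1 := r_gt0 nN.
    have w0 : 0 < (al 0)^-1 by rewrite invr_gt0 alpha_gt0.
    have w1 : 0 < (al 1)^-1 by rewrite invr_gt0 alpha_gt0.
    split; first by ring.
      have := mulr_gt0 r1 w0; have := mulr_ge0 (ltW w1) (sqr_ge0 (q 0)); nra.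
    have := mulr_gt0 (mulr_gt0 r1 w0) (mulr_gt0 w1 (mulr_gt0 r0 r0)); nra.
  have [h0 h1 h2] := IH (ltnW nN); have [-> -> -> ->] := S n.+2.
  have rn := r_gt0 nN.
  have w0 : 0 < (al n.+2)^-1 by rewrite invr_gt0 alpha_gt0.
  move: h0 h1 h2 rn w0; move: (k00 _) (k01 _) (k10 _) (k11 _) (P _ 1 0) (P _ 1 1).
  move: (r _) (_^-1) => rn w a b c d x y h0 h1 h2 rn0 w0.
  have dE : d = - a by lra.
  split; first by rewrite dE; ring.
    have := mulr_ge0 (ltW w0) (sqr_ge0 y); have : rn * b < 0 by rewrite pmulr_rlt0.
    lra.
  have psd : 0 <= - b * x ^+ 2 + 2 * a * x * y + c * y ^+ 2.
    rewrite -(@pmulr_rge0 _ (- b)) ?oppr_gt0//.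
    have -> : - b * (- b * x ^+ 2 + 2 * a * x * y + c * y ^+ 2) =
      (- b * x + a * y) ^+ 2 + (- b * c - a ^+ 2) * y ^+ 2 by ring.
    by rewrite addr_ge0 ?sqr_ge0// mulr_ge0 ?sqr_ge0// subr_ge0 ltW.
  rewrite -subr_gt0.
  have -> : - (rn * b - w * y ^+ 2) * (rn * c + w * x ^+ 2) - (rn * a - w * (x * y)) ^+ 2
    = rn ^+ 2 * (- b * c - a ^+ 2) + rn * w * (- b * x ^+ 2 + 2 * a * x * y + c * y ^+ 2).
    by ring.
  rewrite ltr_pwDl//; last by rewrite mulr_ge0// ltW// mulr_gt0.
  by rewrite mulr_gt0 ?exprn_gt0// subr_gt0.
have := inv (N - 2)%N; have -> : (N - 2).+2 = N by lia.
move=> /(_ (leqnn _)) []; rewrite /k00 /k01 /k10 /k11 prodE !scalar22E discr22E.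
have g2 := gamma2; move: (T N 0 0) (T N 0 1) (T N 1 0) (T N 1 1) => a b c d.
case: gammaE => ->; nra.
Qed.

(** The leading coefficient is - discr (T N), and x0 is where the upper right
    entry of C_0 vanishes; there the discriminant is a square. *)
Lemma hfun_quadratic (s z : int -> R) : exists A B C x0 : R,
  [/\ 0 < A, forall x, hfun N r q s z 0 x = A * x ^+ 2 + B * x + C &
      hfun N r q s z 0 x0 <= 0].
Proof.
have := discr_derivative_lt0; rewrite discr22E => D0.
set D := firstord 0 M (fun l => (al l)^-1 *: mx22 0 0 (s l%:Z) (- z l%:Z)) N.
have hE x : hfun N r q s z 0 x = - ((D 0 0 + x * T N 0 0 - (D 1 1 + x * T N 1 1)) ^+ 2
   + 4 * (D 0 1 + x * T N 0 1) * (D 1 0 + x * T N 1 0)).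
  by rewrite /hfun CmxE discr22E -/D; rewrite !add22E !scale22E.
have T01 : T N 0 1 != 0.
  apply/eqP => T0; move: D0; rewrite T0 mulr0 mul0r addr0.
  by rewrite ltNge sqr_ge0.
exists (- ((T N 0 0 - T N 1 1) ^+ 2 + 4 * T N 0 1 * T N 1 0)),
  (- (2 * (D 0 0 - D 1 1) * (T N 0 0 - T N 1 1) + 4 * (D 0 1 * T N 1 0 + T N 0 1 * D 1 0))),
  (- ((D 0 0 - D 1 1) ^+ 2 + 4 * D 0 1 * D 1 0)), (- D 0 1 / T N 0 1); split.
- by rewrite oppr_gt0.
- by move=> x; rewrite hE; ring.
- rewrite hE divfK// subrr mulr0 mul0r addr0 oppr_le0; exact: sqr_ge0.
Qed.

End LimitMatrix.

(** * Energy of generalised eigenvectors *)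

Section Dynamics.
Variables (R : realType) (N : nat) (a b : nat -> R) (r q s z : int -> R) (gamma : R).
Hypotheses (N_gt0 : (0 < N)%N) (a_gt0 : forall n, 0 < a n).
Hypothesis a_cvg : a n @[n --> \oo] --> +oo.

Let sg n := r n%:Z * a n - a n.-1.
Let zt n := b n - q n%:Z * a n.

Lemma cvg_periodic (x : nat -> R) (l : int -> R) m : nperiodic N l ->
  `|x n - l n%:Z| @[n --> \oo] --> (0 : R) ->
  x (m + k * N)%N @[k --> \oo] --> l m%:Z.
Proof.
move=> lN /norm_cvg0P /(cvg_residue N_gt0 m) h.
have -> : (fun k => x (m + k * N)%N) =
    (fun k => (x (m + k * N)%N - l (m + k * N)%N%:Z) + l m%:Z).
  by apply/funext => k; rewrite periodicM// subrK.
by rewrite -[l m%:Z in X in _ --> X]add0r; apply: cvgD; [exact: h | exact: cvg_cst].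
Qed.

Lemma inva_cvg m : (a (m + k * N)%N)^-1 @[k --> \oo] --> (0 : R).
Proof.
have : (a n)^-1 @[n --> \oo] --> (0 : R).
  by apply/gtr0_cvgV0 => //; apply: nearW => n; exact: a_gt0.
exact: cvg_residue.
Qed.

Lemma periodic_seq_bounded (x : nat -> R) (l : int -> R) : nperiodic N l ->
  `|x n - l n%:Z| @[n --> \oo] --> (0 : R) -> exists B, forall n, `|x n| <= B.
Proof.
move=> lN h; have [Bl hBl] := nperiodic_bounded N_gt0 lN.
have [M [_ hM]] := cvg_seq_bounded (cvgP _ h).
exists (M + 1 + Bl) => n; rewrite -(subrK (l n%:Z) (x n)).
apply: (le_trans (ler_normD _ _)); rewrite lerD// -[leLHS]normr_id.
by apply: hM => //; rewrite ltrDl.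
Qed.

Hypotheses (r_per : nperiodic N r) (s_per : nperiodic N s).
Hypothesis s_cvg : `|sg n - s n%:Z| @[n --> \oo] --> (0 : R).

(** If r l <= 0, then a (n - 1) <= a (n - 1) - r l a n for n = l mod N, and the
    right-hand side is bounded, whereas a tends to infinity. *)
Lemma r_gt0 (l : nat) : 0 < r l%:Z.
Proof.
rewrite ltNge; apply/negP => rl.
have [B hB] := periodic_seq_bounded s_per s_cvg.
have /cvgryPge/(_ (B + 1)) [n _ hn] := cvg_residue N_gt0 (N.-1 + l)%N a_cvg.
have := hn n (leqnn _); rewrite /=.
set p := (N.-1 + l + n * N)%N => ap.
have rE : r p.+1%:Z = r l%:Z.
  have -> : p.+1 = (l + n.+1 * N)%N by rewrite /p; lia.
  exact: periodicM.
have := hB p.+1; rewrite /sg /= rE ler_norml => /andP[h _].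
have : r l%:Z * a p.+1 <= 0 by rewrite pmulr_lle0//; exact: a_gt0.
lra.
Qed.

Hypotheses (q_per : nperiodic N q) (z_per : nperiodic N z).
Hypothesis z_cvg : `|zt n - z n%:Z| @[n --> \oo] --> (0 : R).

(** Everything follows from the identities a (n - 1) = r n a n - sg n,
    a n = (a (n - 1) + sg n) / r n and b n = q n a n + zt n, in which sg, zt,
    1/r and 1/a are bounded. *)
Lemma coefficient_ratios (B0 : R) : exists2 C, 1 <= C &
  forall n x, (0 < n)%N -> `|x| <= B0 -> [/\ a n.-1 <= C * a n, a n <= C * a n.-1,
    `|x - b n| <= C * a n & `|x - b n| <= C * a n.-1].
Proof.
have [B1 h1] := periodic_seq_bounded s_per s_cvg.
have [B2 h2] := periodic_seq_bounded z_per z_cvg.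
have [B3 h3] := nperiodic_bounded N_gt0 r_per.
have [B4 h4] := nperiodic_bounded N_gt0 q_per.
have [B5 h5] : exists B, forall n : nat, `|(r n%:Z)^-1| <= B.
  by apply: (@nperiodic_bounded _ _ N_gt0 (fun i => (r i)^-1)) => i; rewrite r_per.
have [B6 h6] : exists B, forall n : nat, (a n)^-1 <= B.
  have h : (a n)^-1 @[n --> \oo] --> (0 : R).
    by apply/gtr0_cvgV0 => //; apply: nearW => n; exact: a_gt0.
  have [M [_ hM]] := cvg_seq_bounded (cvgP _ h).
  exists (M + 1) => n; apply: (le_trans (ler_norm _)).
  by apply: hM => //; rewrite ltrDl.
have [B le1 lB] := common_bound [:: B0; B1; B2; B3; B4; B5; B6].
have [le0 l1 l2 l3] : [/\ B0 <= B, B1 <= B, B2 <= B & B3 <= B].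
  by split; apply: lB; rewrite !inE eqxx ?orbT.
have [l4 l5 l6] : [/\ B4 <= B, B5 <= B & B6 <= B].
  by split; apply: lB; rewrite !inE eqxx ?orbT.
have BB : B <= B ^+ 2 by rewrite -[leLHS]expr1 ler_weXn2l.
have BBB : B ^+ 2 <= B ^+ 3 by rewrite ler_weXn2l.
have c1 : B + B ^+ 2 <= 2 * B ^+ 3 by lra.
pose C := (3 * B ^+ 2) * (2 * B ^+ 3).
have B3ge : 1 <= B ^+ 3 by apply: exprn_ege1.
have B2ge : 1 <= B ^+ 2 by apply: exprn_ege1.
have C1 : 3 * B ^+ 2 <= C by rewrite /C ler_peMr//; lra.
have C2 : 2 * B ^+ 3 <= C by rewrite /C ler_peMl//; lra.
exists C; first by lra.
move=> n x n0 xB.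
have a0 := a_gt0 n; have a1 := a_gt0 n.-1.
have i0 m : 1 <= B * a m.
  by rewrite -ler_pdivrMr// mul1r; exact: le_trans (h6 m) l6.
have sB : `|sg n| <= B := le_trans (h1 n) l1.
have zB : `|zt n| <= B := le_trans (h2 n) l2.
have rB : r n%:Z * a n <= B * a n.
  by rewrite ler_pM2r// (le_trans (ler_norm _))// (le_trans (h3 n)).
have qB : `|q n%:Z * a n| <= B * a n.
  by rewrite normrM (gtr0_norm a0) ler_pM2r// (le_trans (h4 n)).
have BaB m : B <= B ^+ 2 * a m by rewrite expr2 -mulrA ler_peMr//; lra.
have p2 : a n <= 2 * B ^+ 3 * a n.-1.
  have -> : a n = (r n%:Z)^-1 * (a n.-1 + sg n).
    by rewrite /sg addrC subrK mulrA mulVf ?mul1r// gt_eqF ?r_gt0.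
  apply: (@le_trans _ _ (B * (2 * B ^+ 2 * a n.-1))); last first.
    by rewrite le_eqVlt; apply/orP; left; apply/eqP; ring.
  apply: (le_trans (ler_norm _)); rewrite normrM ler_pM//.
    exact: le_trans (h5 n) l5.
  apply: (le_trans (ler_normD _ _)); rewrite (gtr0_norm a1).
  have := BaB n.-1; have : a n.-1 <= B ^+ 2 * a n.-1 by rewrite ler_peMl// ltW.
  by lra.
have p3 : `|x - b n| <= 3 * B ^+ 2 * a n.
  have -> : x - b n = x - q n%:Z * a n - zt n by rewrite /zt; ring.
  apply: (le_trans (ler_normB _ _)); apply: (le_trans (lerD (ler_normB _ _) zB)).
  have : B * a n <= B ^+ 2 * a n by rewrite ler_pM2r.
  have := BaB n; lra.
split.
- have : 3 * B ^+ 2 * a n <= C * a n by rewrite ler_pM2r.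
  have := BaB n; have : B * a n <= B ^+ 2 * a n by rewrite ler_pM2r.
  by move: sB; rewrite /sg ler_norml => /andP[? ?]; nra.
- by apply: (le_trans p2); rewrite ler_pM2r.
- by apply: (le_trans p3); rewrite ler_pM2r.
- apply: (le_trans p3); rewrite /C -[leRHS]mulrA ler_wpM2l//.
  by lra.
Qed.

Definition energy (u : nat -> R) n := a n * (u n.-1 ^+ 2 + u n ^+ 2).

Lemma energy_ge0 u n : 0 <= energy u n.
Proof. by rewrite mulr_ge0 ?addr_ge0 ?sqr_ge0// ltW. Qed.

Lemma energy_step (B0 : R) : exists2 L, 1 <= L &
  forall x u, `|x| <= B0 -> gen_eigenvector a b x u -> forall n, (0 < n)%N ->
    energy u n.+1 <= L * energy u n /\ energy u n <= L * energy u n.+1.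
Proof.
have [C C1 hC] := coefficient_ratios B0.
have C0 : 0 <= C by lra.
have CC : 1 <= C ^+ 2 by apply: exprn_ege1.
exists (C * (1 + 2 * C ^+ 2)); first by rewrite mulr_ege1//; lra.
move=> x u xB ue n n0.
have [r1 r2 r3 r4] := hC n x n0 xB; have [r5 r6 _ _] := hC n.+1 x isT xB.
have a0 := a_gt0 n; have a1 := a_gt0 n.-1; have a2 := a_gt0 n.+1.
rewrite /= in r5 r6.
have e1 : u n.+1 ^+ 2 <= 2 * C ^+ 2 * (u n ^+ 2 + u n.-1 ^+ 2).
  apply: (@solve_bound _ C (a n) (x - b n) (a n.-1)) => //; last by rewrite gtr0_norm//; exact: a_gt0.
  by rewrite mulrBl -ue//; ring.
have e2 : u n.-1 ^+ 2 <= 2 * C ^+ 2 * (u n ^+ 2 + u n.+1 ^+ 2).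
  apply: (@solve_bound _ C (a n.-1) (x - b n) (a n)) => //; last by rewrite gtr0_norm//; exact: a_gt0.
  by rewrite mulrBl -ue//; ring.
have s0 := sqr_ge0 (u n); have s1 := sqr_ge0 (u n.-1); have s2 := sqr_ge0 (u n.+1).
rewrite /energy /=; split.
- apply: (@le_trans _ _ (C * a n * ((1 + 2 * C ^+ 2) * (u n.-1 ^+ 2 + u n ^+ 2)))).
    by rewrite ler_pM ?addr_ge0//; lra.
  by rewrite le_eqVlt; apply/orP; left; apply/eqP; ring.
- apply: (@le_trans _ _ (C * a n.+1 * ((1 + 2 * C ^+ 2) * (u n ^+ 2 + u n.+1 ^+ 2)))).
    by rewrite ler_pM ?addr_ge0//; lra.
  by rewrite le_eqVlt; apply/orP; left; apply/eqP; ring.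
Qed.

Hypothesis gammaE : gamma = -1 \/ gamma = 1.
Hypothesis prodE : mxprod 0 N (fun i => mx22 0 1 (- r i%:Z) (- q i%:Z)) = gamma%:M.
Hypothesis tv_a : (Nvariation N 0 (fun n => (a n)^-1)%R < +oo)%E.
Hypothesis tv_s : (Nvariation N 1 sg < +oo)%E.
Hypothesis tv_z : (Nvariation N 0 zt < +oo)%E.

Variables (K : set R) (B0 : R).
Hypothesis KB0 : forall x, K x -> `|x| <= B0.

(* The k-th period consists of the indices N + l + k N with l < N; beginning at
   N rather than at 0 keeps the preceding index N - 1 + k N in range. *)
Let M (l : nat) : 'M[R]_2 := mx22 0 1 (- r l%:Z) (- q l%:Z).
Let al (l : nat) := alpha N r l%:Z.
Let A k := a (N.-1 + k * N)%N.
Let kap k l := A k / a (N + l + k * N)%N.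
Let F k x l : 'M[R]_2 :=
  kap k l *: mx22 0 0 (sg (N + l + k * N)%N) (x - zt (N + l + k * N)%N).
Let Rmx k x := firstord (A k)^-1 M (F k x) N.

Definition transfer (n : nat) (x : R) : 'M[R]_2 :=
  mx22 0 1 (- (a n.-1 / a n)) ((x - b n) / a n).

Lemma transfer_perturb k l x :
  transfer (N + k * N + l) x = M l + (A k)^-1 *: F k x l.
Proof.
have A0 : A k != 0 by rewrite gt_eqF// a_gt0.
rewrite addnAC; set n := (N + l + k * N)%N.
have an : a n != 0 by rewrite gt_eqF// a_gt0.
have nE : n = (l + k.+1 * N)%N by rewrite /n; lia.
have rE : r l%:Z = r n%:Z by rewrite nE periodicM.
have qE : q l%:Z = q n%:Z by rewrite nE periodicM.
rewrite /F -/n scalerA /kap -/n mulKf// /sg /zt /M rE qE.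
by apply: eq_mx22; rewrite add22E scale22E !mx22E; field.
Qed.

Lemma period_transfer k x : mxprod 0 N (fun l => transfer (N + k * N + l) x) =
  gamma%:M + (A k)^-1 *: Rmx k x.
Proof.
rewrite -prodE -mxprod_perturb; apply: eq_mxprod => l _; exact: transfer_perturb.
Qed.

Lemma transfer_iter x u m l : gen_eigenvector a b x u -> (0 < m)%N ->
  let P := mxprod 0 l (fun j => transfer (m + j) x) in
  u (m + l).-1 = P 0 0 * u m.-1 + P 0 1 * u m /\
  u (m + l)%N = P 1 0 * u m.-1 + P 1 1 * u m.
Proof.
move=> ue m0 /=; elim: l => [|l [IH1 IH2]].
  by rewrite mxprod_id addn0 !one22E; split; ring.
rewrite addnS mxprod_recr// !mul22E /transfer !mx22E /=; split.
  by rewrite IH2; ring.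
have ml : (0 < m + l)%N by rewrite ltn_addr.
have h := ue _ ml; have an : a (m + l)%N != 0 by rewrite gt_eqF// a_gt0.
apply: (mulfI an).
have -> : a (m + l)%N * u (m + l).+1 =
    x * u (m + l)%N - a (m + l).-1 * u (m + l).-1 - b (m + l)%N * u (m + l)%N.
  by rewrite -h; ring.
by rewrite IH1 IH2; field.
Qed.

Lemma det_transfer x m l : (0 < m)%N ->
  \det (mxprod 0 l (fun j => transfer (m + j) x)) = a m.-1 / a (m + l).-1.
Proof.
move=> m0; elim: l => [|l IH].
  by rewrite mxprod_id det1 addn0 divff// gt_eqF// a_gt0.
rewrite mxprod_recr// det_mulmx IH det22E /transfer !mx22E addnS /=.
have h1 : a (m + l)%N != 0 by rewrite gt_eqF// a_gt0.
have h2 : a (m + l).-1 != 0 by rewrite gt_eqF// a_gt0.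
by field; rewrite h1 h2.
Qed.

Lemma ubv_inva m : ubv K (fun k _ => (a (m + k * N)%N)^-1) (fun=> 0).
Proof. exact: (ubv_residue N_gt0 K tv_a (leq0n m) (inva_cvg m)). Qed.

Lemma ubv_sg m : (0 < m)%N -> ubv K (fun k _ => sg (m + k * N)%N) (fun=> s m%:Z).
Proof. move=> m0; exact: (ubv_residue N_gt0 K tv_s m0 (@cvg_periodic sg s m s_per s_cvg)). Qed.

Lemma ubv_zt m : ubv K (fun k _ => zt (m + k * N)%N) (fun=> z m%:Z).
Proof. exact: (ubv_residue N_gt0 K tv_z (leq0n m) (@cvg_periodic zt z m z_per z_cvg)). Qed.

Lemma ubv_ratio m : (0 < m)%N ->
  ubv K (fun k _ => a (m + k * N).-1 / a (m + k * N)%N) (fun=> r m%:Z).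
Proof.
move=> m0.
apply: (eq_ubv _ _ (ubvB (ubv_cst K (r m%:Z)) (ubvM (ubv_sg m0) (ubv_inva m)))).
  move=> k x _; have an : a (m + k * N)%N != 0 by rewrite gt_eqF// a_gt0.
  by rewrite /sg periodicM//; field.
by move=> x _; rewrite mulr0 subr0.
Qed.

(** A k / a (N + l + k N) is a product of ratios of consecutive coefficients,
    which tend to r 0, ..., r l; their product is the inverse of alpha l. *)
Lemma ubv_kap l : (l < N)%N -> ubv K (fun k _ => kap k l) (fun=> (al l)^-1).
Proof.
have rp j : (j < N)%N -> 0 < r j%:Z by move=> _; exact: r_gt0.
have ratio j : ubv K (fun k _ => a (N + j + k * N).-1 / a (N + j + k * N)%N)
    (fun=> r j%:Z).
  have -> : r j%:Z = r (N + j)%N%:Z by rewrite addnC -[in RHS](mul1n N) periodicM.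
  by apply: ubv_ratio; rewrite ltn_addr.
elim: l => [|l IH] lN.
  apply: (eq_ubv _ _ (ratio 0%N)) => [k x _|x _].
    by rewrite /kap /A; congr (a _ / _); lia.
  have := alpha_pred N_gt0 gammaE prodE lN; rewrite sub0r alphaN1// => h.
  have a0 : al 0 != 0 by rewrite gt_eqF// (alpha_gt0 rp).
  by apply: (mulIf a0); rewrite mulVf// -h.
have a0 : al l != 0 by rewrite gt_eqF// (alpha_gt0 rp)// ltnW.
have a1 : al l.+1 != 0 by rewrite gt_eqF// (alpha_gt0 rp).
apply: (eq_ubv _ _ (ubvM (IH (ltnW lN)) (ratio l.+1))) => [k x _|x _].
  have -> : (N + l.+1 + k * N).-1 = (N + l + k * N)%N by lia.
  have an : a (N + l + k * N)%N != 0 by rewrite gt_eqF// a_gt0.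
  have am : a (N + l.+1 + k * N)%N != 0 by rewrite gt_eqF// a_gt0.
  by rewrite /kap; field; rewrite an am.
have := alpha_pred N_gt0 gammaE prodE lN.
have -> : l.+1%:Z - 1 = l%:Z :> int by lia.
rewrite -/(al l) -/(al l.+1) => h.
by apply: (mulfI a0); rewrite mulrA mulfV// mul1r {1}h mulfK.
Qed.

Lemma mubv_Rmx : mubv K Rmx (fun x => Cmx N r q s z 0 x).
Proof.
have rp j : (j < N)%N -> 0 < r j%:Z by move=> _; exact: r_gt0.
have -> : (fun x => Cmx N r q s z 0 x) = (fun x => firstord 0 M
    (fun l => (al l)^-1 *: mx22 0 0 (s l%:Z) (x - z l%:Z)) N).
  by apply/funext => x; rewrite (Cmx_firstord _ gammaE).
apply: mubv_firstord; first exact: ubv_inva.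
move=> l lN; apply: mubvZ; first exact: ubv_kap.
have perN (f : int -> R) : nperiodic N f -> f l%:Z = f (N + l)%N%:Z.
  by move=> fN; rewrite addnC -[in RHS](mul1n N) periodicM.
move=> i j; rewrite /mx22; under eq_fun do under eq_fun do rewrite mxE.
under [X in ubv _ _ X]eq_fun do rewrite mxE.
case: (i == 0); case: (j == 0); try exact: ubv_cst.
  by rewrite (perN _ s_per); apply: ubv_sg; rewrite ltn_addr.
by rewrite (perN _ z_per); apply: ubvB; [exact: (ubv_param KB0) | exact: ubv_zt].
Qed.

Lemma ubv_discr_Rmx : ubv K (fun k x => - discr (Rmx k x)) (fun x => hfun N r q s z 0 x).
Proof.
have H := mubv_Rmx; have D := ubvB (H 0 0) (H 1 1).
apply: (eq_ubv _ _ (ubvZ (-1) (ubvD (ubvM D D) (ubvZ 4 (ubvM (H 0 1) (H 1 0)))))) => [k|] x _ /=.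
  by rewrite discr22E; ring.
by rewrite /hfun discr22E; ring.
Qed.

Let Q (u : nat -> R) x k :=
  A k * crossform (Rmx k x) (u (N + k * N).-1) (u (N + k * N)%N).

(** Transporting the form of R_k along X_k multiplies it by
    det X_k = A k / A k.+1, which the weight A k.+1 compensates exactly; only the
    increment of R contributes. *)
Lemma turan_step x u k : gen_eigenvector a b x u ->
  Q u x k.+1 - Q u x k =
  A k.+1 * crossform (Rmx k.+1 x - Rmx k x) (u (N + k.+1 * N).-1) (u (N + k.+1 * N)%N).
Proof.
move=> ue; have m0 : (0 < N + k * N)%N by rewrite ltn_addr.
have := transfer_iter N ue m0; have := det_transfer x N m0.
rewrite /= period_transfer; set X := (gamma%:M + _) => dX [u1 u2].
have nE : (N + k.+1 * N = N + k * N + N)%N by lia.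
have T := crossform_transport (Rmx k x) gamma (A k)^-1 (u (N + k * N).-1) (u (N + k * N)%N).
rewrite /= -/X -u1 -u2 dX -nE in T.
rewrite crossformB mulrBr T /Q; congr (_ - _).
have -> : (N + k * N).-1 = (N.-1 + k * N)%N by lia.
have -> : (N + k.+1 * N).-1 = (N.-1 + k.+1 * N)%N by lia.
rewrite -/(A k) -/(A k.+1); set c := crossform _ _ _.
by have A1 : A k.+1 != 0; [rewrite gt_eqF// a_gt0 | field].
Qed.

Lemma energy_periods (delta : R) : 0 < delta ->
  (forall x, K x -> delta <= hfun N r q s z 0 x) ->
  exists n0 W, [/\ (0 < n0)%N, 1 <= W & forall x u, K x -> gen_eigenvector a b x u ->
    forall k, energy u (n0 + k * N) <= W * energy u n0 /\
              energy u n0 <= W * energy u (n0 + k * N)].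
Proof.
move=> d0 hK.
have [e [B' [e0 se hd hb']]] := mubv_unif mubv_Rmx.
have [B B1 /(_ B' (mem_head _ _)) BB'] := common_bound [:: B'].
have hb k x i j : K x -> `|Rmx k x i j| <= B.
  by move=> Kx; apply: le_trans BB'; exact: hb'.
have [C C1 hC] := coefficient_ratios B0.
have [k1 hk1] := ubv_ge d0 ubv_discr_Rmx hK.
(* For c = 32 B / delta, coercivity of the form with constant delta / 2 reads
   2 V j <= c |Q j|, and increments of R of size e j change Q by at most
   2 e j V <= c e j |Q|. *)
pose c := 32 * B / delta.
have c0 : 0 < c by rewrite divr_gt0//; lra.
have t0 : 0 < 2^-1 / c by rewrite divr_gt0// invr_gt0.
have [k2 hk2] := bounded_series_tail e0 se t0.
pose k0 := maxn k1 k2; pose n0 := (N + k0 * N)%N.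
exists n0, (1 + C ^+ 2 * (2 * c * B)).
have C0 : 0 <= C by lra.
have B_ge0 : 0 <= B by lra.
have cB0 : 0 <= 2 * c * B by rewrite mulr_ge0// pmulr_rge0// ltW.
split; first by apply: ltn_addr.
  by rewrite lerDl mulr_ge0// exprn_ge0.
move=> x u Kx ue k.
pose V j := A j * (u (N + j * N).-1 ^+ 2 + u (N + j * N)%N ^+ 2).
have y0 j : 0 <= u (N + j * N).-1 ^+ 2 + u (N + j * N)%N ^+ 2.
  by rewrite addr_ge0 ?sqr_ge0.
have V0 j : 0 <= V j by rewrite mulr_ge0// ltW// a_gt0.
have AE j : A j = a (N + j * N).-1 by rewrite /A; congr a; lia.
have EV j : energy u (N + j * N) <= C * V j /\ V j <= C * energy u (N + j * N).
  have [|h1 h2 _ _] := hC (N + j * N)%N x _ (KB0 Kx); first by rewrite ltn_addr.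
  by rewrite /energy /V AE !mulrA; split; apply: ler_wpM2r.
have QV j : `|Q u x j| <= 2 * B * V j.
  rewrite /Q normrM gtr0_norm ?a_gt0// /V mulrCA ler_wpM2l ?(ltW (a_gt0 _))//.
  by apply: crossform_bound => i i'; exact: hb.
have VQ j : (k0 <= j)%N -> 2 * V j <= c * `|Q u x j|.
  move=> k0j; have := hk1 j x Kx (leq_trans (leq_maxl _ _) k0j) => hdj.
  have d2 : 0 <= delta / 2 by lra.
  have := @crossform_coercive _ (Rmx j x) B (delta / 2) (u (N + j * N).-1) (u (N + j * N)%N)
    (fun i i' => hb _ _ _ _ Kx) hdj d2.
  move=> /(ler_wpM2l (ltW (a_gt0 (N.-1 + j * N)%N))); rewrite -/(A j) => h.
  rewrite /c mulrAC ler_pdivlMr// /Q normrM (gtr0_norm (a_gt0 _)) -/(A j) /V.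
  by move: h; set cf := `|crossform _ _ _|; set S := _ + _; move=> h; lra.
pose eta j := c * e (k0 + j)%N.
have [] := @gronwall_comparable _ (fun j => Q u x (k0 + j)%N) eta _ _ _ k.
- by move=> j; rewrite mulr_ge0// ltW.
- move=> m; rewrite -mulr_sumr -ler_pdivlMl// mulrC.
  exact: hk2 (leq_maxr _ _).
- move=> j; rewrite addnS turan_step// normrM (gtr0_norm (a_gt0 _)) -/(A _).
  have k0j : (k0 <= (k0 + j).+1)%N by rewrite -addnS leq_addr.
  apply: (@le_trans _ _ (e (k0 + j)%N * (2 * V (k0 + j).+1))); last first.
    by rewrite /eta [c * _]mulrC -mulrA ler_wpM2l// VQ.
  have := @crossform_bound _ (Rmx (k0 + j).+1 x - Rmx (k0 + j)%N x) (e (k0 + j)%N)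
    (u (N + (k0 + j).+1 * N).-1) (u (N + (k0 + j).+1 * N)%N) (fun i i' => hd _ _ _ _ Kx).
  move=> /(ler_wpM2l (ltW (a_gt0 (N.-1 + (k0 + j).+1 * N)%N))) /le_trans; apply.
  by rewrite -/(A _) /V le_eqVlt; apply/orP; left; apply/eqP; ring.
rewrite addn0 => q1 q2.
have -> : (n0 + k * N)%N = (N + (k0 + k) * N)%N by rewrite mulnDl addnA.
have [E1 E2] := EV k0; have [E3 E4] := EV (k0 + k)%N; rewrite -/n0 in E1 E2.
have h1 := VQ k0 (leqnn _); have h2 := VQ (k0 + k)%N (leq_addr _ _).
have key i j : 2 * V i <= c * `|Q u x i| -> `|Q u x i| <= 2 * `|Q u x j| ->
    energy u (N + i * N) <= (1 + C ^+ 2 * (2 * c * B)) * energy u (N + j * N).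
  move=> hi hij; have [Ei _] := EV i; have [_ Ej] := EV j.
  have Vij : V i <= 2 * c * B * V j.
    have g1 : c * `|Q u x i| <= c * (2 * (2 * B * V j)).
      by rewrite ler_pM2l// (le_trans hij)// ler_pM2l.
    by move: hi g1; move: (V i) (V j) (`|Q u x i|) => *; lra.
  have g2 : C * V i <= C * (2 * c * B * (C * energy u (N + j * N))).
    by rewrite ler_wpM2l// (le_trans Vij)// ler_wpM2l.
  apply: (le_trans Ei); apply: (le_trans g2).
  have := energy_ge0 u (N + j * N); set w := energy _ _ => w0.
  have -> : C * (2 * c * B * (C * w)) = C ^+ 2 * (2 * c * B) * w by ring.
  by rewrite [leRHS]mulrDl mul1r lerDr.
by split; apply: key.
Qed.

End Dynamics.

(** * The main estimate *)

Theorem theoremC (R : realType) (N : nat) (a b : nat -> R)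
    (r q s z : int -> R) (gamma : R)
    (N_gt0 : (0 < N)%N)
    (a_gt0 : forall n : nat, 0 < a n)
    (r_per : nperiodic N r) (q_per : nperiodic N q)
    (gammaE : gamma = -1 \/ gamma = 1)
    (prodE : mxprod 0 N (fun i => mx22 0 1 (- r i%:Z) (- q i%:Z)) = gamma%:M)
    (tv_fin : (Nvariation N 0 (fun n => (a n)^-1)%R
               + Nvariation N 1 (fun n => r n%:Z * a n - a n.-1)%R
               + Nvariation N 0 (fun n => b n - q n%:Z * a n)%R < +oo)%E)
    (s_per : nperiodic N s) (z_per : nperiodic N z)
    (a_cvg : a n @[n --> \oo] --> +oo)
    (s_cvg : `|r n%:Z * a n - a n.-1 - s n%:Z| @[n --> \oo] --> (0 : R))
    (z_cvg : `|b n - q n%:Z * a n - z n%:Z| @[n --> \oo] --> (0 : R)) :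
  (exists c d : R, c <= d /\ Iset N r q s z = `[c, d]%classic) /\
  (forall K : set R, compact K -> K `<=` Lambda N r q s z ->
    exists c1 c2 : R, [/\ 0 < c1, 0 < c2 &
      forall x : R, K x ->
      forall u : nat -> R, gen_eigenvector a b x u ->
      forall n : nat, (1 <= n)%N ->
        c1 * (u 0%N ^+ 2 + u 1%N ^+ 2) <= a n * (u n.-1 ^+ 2 + u n ^+ 2) /\
        a n * (u n.-1 ^+ 2 + u n ^+ 2) <= c2 * (u 0%N ^+ 2 + u 1%N ^+ 2)]).
Proof.
have [tva tvs tvz] : [/\ (Nvariation N 0 (fun n => (a n)^-1)%R < +oo)%E,
    (Nvariation N 1 (fun n => r n%:Z * a n - a n.-1)%R < +oo)%E &
    (Nvariation N 0 (fun n => b n - q n%:Z * a n)%R < +oo)%E].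
  by apply: lt_pinfty_add3 tv_fin; exact: Nvariation_ge0.
have r_pos l : 0 < r l%:Z by exact: (r_gt0 N_gt0 a_gt0 a_cvg r_per s_per s_cvg).
have [A [B [C [x0 [A0 hE hx0]]]]] :=
  hfun_quadratic N_gt0 gammaE (fun l _ => r_pos l) prodE s z.
split; first exact: quadratic_le0_itv hE A0 hx0.
move=> K cK KL.
have hK x : K x -> 0 < hfun N r q s z 0 x by move=> /KL /negP; rewrite -ltNge.
have [delta d0 hd] := quadratic_compact_lower_bound hE cK hK.
have [B0 KB0] : exists B0, forall x, K x -> `|x| <= B0.
  have [M [_ hM]] := compact_bounded cK; exists (M + 1) => x Kx.
  by apply: (hM (M + 1)) => //; rewrite ltrDl.
have [n0 [W [n0_gt0 W1 hW]]] := energy_periods N_gt0 a_gt0 a_cvg r_per s_per s_cvg q_per z_per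
  z_cvg gammaE prodE tva tvs tvz KB0 d0 hd.
have [L L1 hL] := energy_step N_gt0 a_gt0 a_cvg r_per s_per s_cvg q_per z_per z_cvg B0.
have [Z Z0 hZ] := fill_gaps L1 W1 n0_gt0 N_gt0.
have a1 := a_gt0 1%N.
exists (Z^-1 * a 1%N), (Z * a 1%N); split; [by rewrite mulr_gt0 ?invr_gt0 | exact: mulr_gt0 |].
move=> x Kx u ue n n_gt0.
have [h1 h2] := hZ (energy a u) (energy_ge0 a_gt0 u) (hL x u (KB0 x Kx) ue) (hW x u Kx ue) n n_gt0.
by split; rewrite -mulrA// ler_pdivrMl.
Qed.
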